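(* If $X$ is a random set in $\mathfrak{X}$, then its conditional convex hull $\mathbf{M}(X|\mathcal{H})$ exists, and $$h_{\mathbf{M}(X|\mathcal{H})}(\zeta)=\operatorname{ess\,sup}_{\mathcal{H}} h_X(\zeta)\quad\text{a.s.},\qquad \zeta\in\mathcal{L}^0(\mathfrak{X}^*,\mathcal{H}).$$
   Context: $\mathfrak{X}$ is a separable real Banach space with Borel $\sigma$-algebra $\mathcal{B}(\mathfrak{X})$; $(\Omega,\mathcal{F},\mathbf{P})$ is a complete probability space and $\mathcal{H}\subset\mathcal{F}$ is a sub-$\sigma$-algebra. An $\mathcal{H}$-measurable random set is a set-valued function $\omega\mapsto X(\omega)\subset\mathfrak{X}$ (empty values allowed) whose graph belongs to $\mathcal{H}\otimes\mathcal{B}(\mathfrak{X})$; ''random set'' means $\mathcal{F}$-measurable; it is closed (convex) if its values are closed (convex) for almost all $\omega$. The conditional convex hull $\mathbf{M}(X|\mathcal{H})$ is the smallest (with respect to a.s. inclusion) $\mathcal{H}$-measurable random convex closed set which a.s. contains $X$. $\mathfrak{X}^*$ is the dual space with pairing $\langle u,x\rangle$ and the $\sigma(\mathfrak{X}^*,\mathfrak{X})$-topology; $\mathcal{L}^0(\mathfrak{X}^*,\mathcal{H})$ is the family of $\zeta:\Omega\to\mathfrak{X}^*$ such that $\langle\zeta,x\rangle$ is an $\mathcal{H}$-measurable random variable for all $x\in\mathfrak{X}$. The support function is $h_X(u)=\sup\{\langle u,x\rangle:\ x\in X\}$, equal to $-\infty$ for empty $X$, and $h_X(\zeta)$ denotes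 $\omega\mapsto h_{X(\omega)}(\zeta(\omega))$. For a $[-\infty,\infty]$-valued random variable $\eta$, $\operatorname{ess\,sup}_{\mathcal{H}}\eta$ is the (a.s. unique) smallest $\mathcal{H}$-measurable $[-\infty,\infty]$-valued random variable that is a.s. greater than or equal to $\eta$. *)

(* Defs.v *)
From HB Require Import structures.
From mathcomp Require Import all_boot all_order all_algebra.
From mathcomp Require Import all_classical all_reals all_analysis.
From mathcomp Require Import measurable_realfun.

Set Implicit Arguments.
Unset Strict Implicit.
Unset Printing Implicit Defensive.

Import Order.TTheory GRing.Theory Num.Theory.
Import numFieldNormedType.Exports.

Local Open Scope classical_set_scope.
Local Open Scope ring_scope.

Definition separable (E : topologicalType) : Prop :=
  exists2 D : set E, countable D & dense D.

(* A sub-sigma-algebra is kept as a family of sets, and the measurable space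
   it induces on the same carrier is [g_sigma_algebraType H]; the sigma-algebra
   generated by [H] is [H] itself when [H] is a sigma-algebra. *)
Definition sub_sigma_algebra_of (d : measure_display) (T : measurableType d)
    (H : set_system T) : Prop :=
  sigma_algebra [set: T] H /\ H `<=` measurable.

Definition measurable_wrt (d d' : measure_display) (T : measurableType d)
    (U : measurableType d') (H : set_system T) (f : T -> U) : Prop :=
  measurable_fun [set: g_sigma_algebraType H] (f : g_sigma_algebraType H -> U).

Section random_sets.
Context (R : realType) (V : completeNormedModType R).
Context (d : measure_display) (T : measurableType d) (P : probability T R).

Definition random_set (H : set_system T) (X : T -> set V) : Prop :=
  measurable ([set p | X p.1 p.2] :
    set (g_sigma_algebraType H * g_sigma_algebraType (@open V))%type).

Definition as_closed (X : T -> set V) : Prop := {ae P, forall w, closed (X w)}.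

Definition as_convex (X : T -> set V) : Prop :=
  {ae P, forall w, @convex_set R V (X w)}.

Definition as_subset (X Y : T -> set V) : Prop :=
  {ae P, forall w, X w `<=` Y w}.

Definition closed_convex_superset (H : set_system T) (X Y : T -> set V)
    : Prop :=
  [/\ random_set H Y, as_closed Y, as_convex Y & as_subset X Y].

(* [M] is a version of the conditional convex hull of [X] given [H], which is
   determined only up to almost sure equality. *)
Definition is_cond_convex_hull (H : set_system T) (X M : T -> set V) : Prop :=
  closed_convex_superset H X M /\
  forall Y, closed_convex_superset H X Y -> as_subset M Y.

(* [e] is a version of the [H]-conditional essential supremum, an operation
   that applies to extended random variables [eta] only. *)
Definition is_cond_ess_sup (H : set_system T) (eta e : T -> \bar R) : Prop :=
  [/\ measurable_fun [set: T] eta,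
      measurable_wrt H e,
      {ae P, forall w, (eta w <= e w)%E} &
      forall e' : T -> \bar R, measurable_wrt H e' ->
        {ae P, forall w, (eta w <= e' w)%E} ->
        {ae P, forall w, (e w <= e' w)%E}].

End random_sets.

Record dual (R : realType) (V : completeNormedModType R) := Dual {
  dual_fun :> {linear V -> R^o};
  dual_continuous : continuous dual_fun }.

(* The space L^0(V^*, H): measurability is scalar, against every vector. *)
Definition L0_dual (R : realType) (V : completeNormedModType R)
    (d : measure_display) (T : measurableType d) (H : set_system T)
    (zeta : T -> dual V) : Prop :=
  forall x : V, measurable_wrt H (fun w => zeta w x : R).

(* The supremum in [\bar R] of the empty set is [-oo]. *)
Definition support_function (R : realType) (V : completeNormedModType R)
    (A : set V) (u : dual V) : \bar R :=
  ereal_sup [set (u x : R)%:E | x in A].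

(* Main.v *)
Require Import Defs.
From mathcomp Require Import all_boot all_order all_algebra.
From mathcomp Require Import all_classical all_reals all_analysis.
From mathcomp Require Import measurable_realfun.

Set Implicit Arguments.
Unset Strict Implicit.
Unset Printing Implicit Defensive.

Import Order.TTheory GRing.Theory Num.Theory.
Import numFieldNormedType.Exports.

Local Open Scope classical_set_scope.
Local Open Scope ring_scope.

(** The hull exists by minimization. Random convex closed supersets of [X]
    measurable for [H] are stable under countable intersections. Fix a
    countable base [U n] of [V]: for each [n] some superset [Y n] makes the
    event that it meets [U n] almost surely smallest ([directed_ae_minimum]).
    The intersection of all the [Y n] is the hull, because a closed set is
    determined by the basic open sets that it meets.

    For the support functions, let [e] be the conditional essential supremum
    of [h_X(zeta)]. Cutting a hull [M] by the random half-space where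
    [zeta <= e] leaves an [H]-measurable convex closed superset of [X], so
    minimality of [M] puts [M] inside the half-space: [h_M(zeta) <= e].
    Conversely [h_M(zeta)] dominates [h_X(zeta)], and it is almost surely
    equal to an [H]-measurable variable, so minimality of [e] gives
    [e <= h_M(zeta)].

    Both halves need events of the form: a random set is nonempty. These are
    projections of sets in a product sigma-algebra, and the core of the
    development is [measurable_projection]: such an event is squeezed, up to a
    null set, between members of [H]. Points of [V] are coded by sequences of
    naturals, namely the indices of fast convergent sequences in a dense
    sequence. Through this coding a set of the product sigma-algebra becomes a
    Souslin family over [H] ([measurable_bicoded]), so that its projection is
    the result of one Souslin operation, which preserves measurability up to
    null sets ([souslin_sandwiched]). *)

(** * Essential minima and the Souslin operation *)

Lemma inv_natS_lt (R : realType) (e : R) : 0 < e ->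
  exists N, forall n, (N <= n)%N -> n.+1%:R^-1 < e.
Proof.
move=> e0; have [N _ HN] := near_infty_natSinv_lt (PosNum e0).
by exists N => n Nn; exact: HN.
Qed.

Section essential_minimum.
Context (d : measure_display) (T : measurableType d) (R : realType).
Variable P : {finite_measure set T -> \bar R}.
Local Open Scope ereal_scope.

(** A countable lower bound of a sequence whose measures approach the infimum
    attains the infimum. Any other member [C] has a common lower bound with
    this minimizer; its measure cannot drop, so the minimizer exceeds [C] by a
    null set only. *)
Lemma directed_ae_minimum (G : set (set T)) :
  G !=set0 -> G `<=` measurable ->
  (forall A : (set T)^nat, (forall n, G (A n)) ->
     exists2 B, G B & forall n, P (B `\` A n) = 0) ->
  exists2 B, G B & forall C, G C -> P (B `\` C) = 0.
Proof.
move=> [A0 GA0] Gm down.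
have Pfin A : measurable A -> P A \is a fin_num by exact: fin_num_measure.
have le_ae A B : measurable A -> measurable B -> P (A `\` B) = 0 ->
    P A <= P (A `&` B).
  move=> mA mB AB0.
  have -> : P A = P (A `\` B) + P (A `&` B) by exact: measureDI.
  by rewrite AB0 add0e.
set m := ereal_inf (P @` G).
have m_le A : G A -> m <= P A by move=> GA; apply: ereal_inf_lbound; exists A.
have mfin : m \is a fin_num.
  rewrite ge0_fin_numE; last by apply: le_ereal_inf_tmp => _ [A _ <-].
  by rewrite (le_lt_trans (m_le _ GA0))// ltey_eq Pfin//; exact: Gm.
have Aex n : exists A, G A /\ P A < m + (n.+1%:R^-1)%:E.
  have n0 : (0 < n.+1%:R^-1 :> R)%R by rewrite invr_gt0.
  by have [_ [A GA <-] Am] := lb_ereal_inf_adherent n0 mfin; exists A.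
have {Aex}[A HA] := choice Aex.
have [n|B GB BA] := down A; first by case: (HA n).
have PBm : P B <= m.
  apply/lee_addgt0Pr => e e0.
  have [n /(_ n (leqnn n)) ne] := inv_natS_lt e0.
  have [GAn /ltW Anm] := HA n.
  apply: (le_trans (le_ae _ _ (Gm _ GB) (Gm _ GAn) (BA n))).
  apply: (@le_trans _ _ (P (A n))).
    by apply: measureIr; exact: Gm.
  by apply: (le_trans Anm); rewrite leeD2l// lee_fin ltW.
exists B => // C GC.
have mB := Gm _ GB; have mC := Gm _ GC.
(* a common lower bound of B and C *)
have [|B' GB' B'0] := down (fun n => if n is 0%N then B else C).
  by case.
have mB' := Gm _ GB'.
have PBC : P B <= P (B `&` C).
  apply: (le_trans PBm); apply: (le_trans (m_le _ GB')).
  apply: (le_trans (le_ae _ _ mB' mB (B'0 0%N))).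
  have mBB : measurable (B' `&` B) by exact: measurableI.
  apply: (@le_trans _ _ (P ((B' `&` B) `&` C))).
    apply: le_ae => //; apply/eqP; rewrite -measure_le0 -(B'0 1%N).
    by apply: le_measure; rewrite ?inE; [exact: measurableD|exact: measurableD|
      apply: setSD; exact: subIsetl].
  by apply: le_measure; rewrite ?inE;
    [exact: measurableI|exact: measurableI|apply: setSI; exact: subIsetr].
apply/eqP; rewrite -measure_le0.
have mBC : measurable (B `&` C) by exact: measurableI.
have PE : P B = P (B `\` C) + P (B `&` C) by exact: measureDI.
by move: PBC; rewrite PE -[leRHS]add0e leeD2rE// Pfin.
Qed.

End essential_minimum.

Section souslin.
Context (d : measure_display) (T : measurableType d) (R : realType).
Variables (P : {finite_measure set T -> \bar R}) (H : set_system T).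
Hypothesis subH : sub_sigma_algebra_of H.

Lemma sub_measurable (A : set T) : H.-sigma.-measurable A -> measurable A.
Proof.
by case: subH => sH mH; rewrite measurable_g_measurableTypeE// => /mH.
Qed.

Lemma measurable_hull (S : set T) : exists B,
  [/\ H.-sigma.-measurable B, S `<=` B &
    forall C, H.-sigma.-measurable C -> S `<=` C -> P (B `\` C) = 0%E].
Proof.
have [||A GA|B [mB SB] Bmin] := @directed_ae_minimum _ T R P
  [set B : set T | H.-sigma.-measurable B /\ S `<=` B].
- by exists setT; split => //; exact: measurableT.
- by move=> B [/sub_measurable].
- exists (\bigcap_n A n).
    split; first by apply: bigcapT_measurable => n; case: (GA n).
    by move=> w Sw n _; case: (GA n) => _; exact.
  by move=> n; rewrite (_ : _ `\` _ = set0) ?measure0// -subset0 => w [+ +];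
    move=> /(_ n I).
by exists B; split => // C mC SC; apply: Bmin.
Qed.

(** Membership of [S] in the completion of [H] under [P], with the witnesses
    kept in [H] itself. *)
Definition sandwiched (S : set T) := exists B N,
  [/\ H.-sigma.-measurable B, H.-sigma.-measurable N, P N = 0%E,
    S `<=` B & B `\` N `<=` S].

(** Let [S s] be the part of the Souslin set reached by the branches through
    the node [s], and [B s] its hull in [H]. Since [S s] is contained in [A s]
    and in the union of the [S (rcons s k)], minimality of the hull makes
    [N s] null. A point of [B [::]] outside every [N s] can be pushed from each
    node to one of its children for ever; the branch so obtained shows that the
    point lies in the Souslin set. *)
Lemma souslin_sandwiched (K : countType) (k0 : K) (A : seq K -> set T) :
  (forall s, H.-sigma.-measurable (A s)) ->
  sandwiched [set w | exists p, forall n, A (mkseq p n) w].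
Proof.
move=> mA.
pose S s := [set w | exists p : nat -> K,
  mkseq p (size s) = s /\ forall n, A (mkseq p n) w].
have [B HB] := choice (fun s => measurable_hull (S s)).
pose N s := (B s `\` A s) `|` (B s `\` \bigcup_k B (rcons s k)).
have mB s : H.-sigma.-measurable (B s) by case: (HB s).
have mU s : H.-sigma.-measurable (\bigcup_k B (rcons s k)).
  by apply: countable_bigcupT_measurable => //; exact: countableP.
have mN s : H.-sigma.-measurable (N s).
  by apply: measurableU; apply: measurableD.
have N0 s : P (N s) = 0%E.
  have [_ _ hullB] := HB s.
  apply: null_set_setU; try exact/sub_measurable/measurableD.
    apply: hullB => // w [p [ps Aw]]; rewrite -ps; exact: Aw.
  apply: hullB => // w [p [ps Aw]]; exists (p (size s)) => //.
  case: (HB (rcons s (p (size s)))) => _ + _; apply.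
  by exists p; rewrite size_rcons mkseqS ps.
exists (B [::]), (\bigcup_s N s); split => //.
- by apply: countable_bigcupT_measurable => //; exact: countableP.
- apply/negligibleP.
    apply: countable_bigcupT_measurable; first exact: countableP.
    by move=> s; exact: sub_measurable.
  have neglN o : P.-negligible (oapp N set0 o).
    case: o => [s|] /=; last exact: negligible_set0.
    by apply/negligibleP; [exact: sub_measurable|exact: N0].
  apply: (@negligibleS _ _ _ P (\bigcup_n oapp N set0 (unpickle n))).
    by move=> w [s _ Nw]; exists (pickle s) => //; rewrite pickleK.
  exact: negligible_bigcup.
- move=> w [p Aw]; case: (HB [::]) => _ + _; apply; by exists p.
move=> w [Bw Nw].
have step s : exists k, B s w -> B (rcons s k) w.
  have [Bsw|] := pselect (B s w); last by exists k0.
  apply: contrapT => noext; apply: Nw; exists s => //; right; split => //.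
  by move=> [k _ Bk]; apply: noext; exists k.
have [f Hf] := choice step.
pose q := fix q n := if n is m.+1 then rcons (q m) (f (q m)) else [::].
have qE n : mkseq (f \o q) n = q n.
  by elim: n => // n IH; rewrite mkseqS IH.
have Bq n : B (q n) w by elim: n => //= n; exact: Hf.
exists (f \o q) => n; rewrite qE.
by apply: contrapT => nA; apply: Nw; exists (q n) => //; left.
Qed.

End souslin.

(** * Souslin families and projections *)

Definition agree (K : Type) (m : nat) (s t : nat -> K) :=
  forall i, (i < m)%N -> s i = t i.

Lemma agreeW (K : Type) (m n : nat) (s t : nat -> K) :
  (m <= n)%N -> agree n s t -> agree m s t.
Proof. by move=> mn st i im; apply: st; exact: leq_trans mn. Qed.

Section souslin_families.
Context (T : pointedType) (H : set_system T).
Implicit Types (s t : nat -> nat) (w : T).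

(** Continuity, for the product topology on sequences, of a map into the
    discrete set of the events of [H]. *)
Definition locally_constant1 (F : (nat -> nat) -> set T) := forall s,
  H.-sigma.-measurable (F s) /\
  exists m, forall s', agree m s s' -> F s' = F s.

Definition locally_constant2 (F : (nat -> nat) -> (nat -> nat) -> set T) :=
  forall s t, H.-sigma.-measurable (F s t) /\
  exists m, forall s' t', agree m s s' -> agree m t t' -> F s' t' = F s t.

(** A subset of [T * (nat -> nat)], given by its sections at [s], that results
    from the Souslin operation. The second parameter [t] is the branch: keeping
    it as a whole sequence on which the events depend locally, instead of
    indexing events by finite sequences, makes branches easy to combine. *)
Definition souslin_family (E : (nat -> nat) -> set T) :=
  exists2 F : nat -> (nat -> nat) -> (nat -> nat) -> set T,
    forall n, locally_constant2 (F n) &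
    forall s w, E s w <-> exists t, forall n, F n s t w.

Lemma souslin_family_locally_constant E :
  locally_constant1 E -> souslin_family E.
Proof.
move=> lE; exists (fun _ s _ => E s).
  move=> _ s t; have [mE [m Em]] := lE s; split => //.
  by exists m => s' t' ss' _; exact: Em.
by move=> s w; split=> [Esw|[_ /(_ 0%N)]//]; exists (fun=> 0%N).
Qed.

(** The first entry of the branch selects the member of the union. *)
Lemma souslin_family_bigcup (E : nat -> (nat -> nat) -> set T) :
  (forall k, souslin_family (E k)) -> souslin_family (fun s => \bigcup_k E k s).
Proof.
move=> /(_ _)/cid2 sE.
pose F k := sval (sE k); have lF k : forall n, locally_constant2 (F k n).
  by rewrite /F; case: (sE k).
have EF k : forall s w, E k s w <-> exists t, forall n, F k n s t w.
  by rewrite /F; case: (sE k).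
exists (fun n s t => F (t 0%N) n s (fun i => t i.+1)).
  move=> n s t; have [mF [m Fm]] := lF (t 0%N) n s (fun i => t i.+1).
  split => //; exists m.+1 => s' t' ss' tt'; rewrite -(tt' 0%N)//.
  by apply: Fm; [exact: agreeW ss'|move=> i im; exact: tt'].
move=> s w; split=> [[k _ /EF[t Ft]]|[t Ft]].
  by exists (fun i => if i is j.+1 then t j else k).
by exists (t 0%N) => //; apply/EF; exists (fun i => t i.+1).
Qed.

(** A single branch carries countably many branches as the rows of a matrix
    indexed by pairs; an entry of any row depends on one entry of the branch,
    so local dependence is preserved. *)
Lemma souslin_family_bigcap (E : nat -> (nat -> nat) -> set T) :
  (forall k, souslin_family (E k)) -> souslin_family (fun s => \bigcap_k E k s).
Proof.
move=> /(_ _)/cid2 sE.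
pose F k := sval (sE k); have lF k : forall n, locally_constant2 (F k n).
  by rewrite /F; case: (sE k).
have EF k : forall s w, E k s w <-> exists t, forall n, F k n s t w.
  by rewrite /F; case: (sE k).
pose row (k : nat) t (j : nat) : nat := t (pickle (k, j)).
exists (fun n s t =>
  if (unpickle n : option (nat * nat)) is Some (k, j) then F k j s (row k t)
  else setT).
  move=> n s t; case: (@unpickle (nat * nat)%type n) => [[k j]|]; last first.
    by split; [exact: measurableT|exists 0%N].
  have [mF [m Fm]] := lF k j s (row k t); split => //.
  pose M := (\max_(i < m) pickle (k, (i : nat))).+1.
  exists (maxn m M) => s' t' ss' tt'; apply: Fm.
    by apply: agreeW ss'; exact: leq_maxl.
  move=> i im; apply: tt'; rewrite (leq_trans _ (leq_maxr _ _))// ltnS.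
  exact: (@leq_bigmax _ (fun i : 'I_m => pickle (k, (i : nat))) (Ordinal im)).
move=> s w; split=> [Ew|[t Ft] k _].
  have /choice[t Ht] k : exists t, forall n, F k n s t w by exact/EF/Ew.
  exists (fun n =>
    if (unpickle n : option (nat * nat)) is Some (k, j) then t k j
    else 0%N) => n.
  case: (@unpickle (nat * nat)%type n) => [[k j]|]//.
  rewrite (_ : row k _ = t k)//; apply/funext => i.
  by rewrite /row pickleK.
apply/EF; exists (row k t) => n.
by have := Ft (pickle (k, n)); rewrite pickleK.
Qed.

End souslin_families.

Section souslin_projection.
Context (d : measure_display) (T : measurableType d) (R : realType).
Variables (P : {finite_measure set T -> \bar R}) (H : set_system T).
Hypothesis subH : sub_sigma_algebra_of H.

(** Projecting along [s] merges [s] and [t] into one branch in [nat * nat]. To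
    return to events indexed by finite sequences, a node imposes those
    conditions [G n] whose value it already determines; by local constancy each
    condition is imposed somewhere along every branch. *)
Lemma souslin_family_sandwiched (E : (nat -> nat) -> set T) :
  souslin_family H E -> sandwiched P H [set w | exists s, E s w].
Proof.
move=> [F lF EF].
pose K := (nat * nat)%type.
pose G n (p : nat -> K) := F n (fst \o p) (snd \o p).
pose ext (q : seq K) := nth (0, 0)%N q.
pose fixed n q := forall p, agree (size q) p (ext q) -> G n p = G n (ext q).
pose A q := \bigcap_n (if `[< fixed n q >] then G n (ext q) else setT).
have mA q : H.-sigma.-measurable (A q).
  apply: bigcapT_measurable => n; case: ifP => // _.
  by case: (lF n (fst \o ext q) (snd \o ext q)).
have ext_mkseq p m : agree m p (ext (mkseq p m)).
  by move=> i im; rewrite /ext nth_mkseq.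
have := souslin_sandwiched P subH (0, 0)%N mA.
rewrite (_ : [set w | _] = [set w | exists s, E s w])//.
apply/seteqP; split => w /=.
  move=> [p Aw]; exists (fst \o p); apply/EF; exists (snd \o p) => n.
  have [_ [m Fm]] := lF n (fst \o p) (snd \o p).
  have Gp p' : agree m p p' -> G n p' = G n p.
    by move=> pp'; apply: Fm => i im /=; rewrite pp'.
  have /asboolP fixn : fixed n (mkseq p m).
    move=> p'; rewrite size_mkseq => p'p.
    rewrite [RHS]Gp; last exact: ext_mkseq.
    by apply: Gp => i im; rewrite p'p//; exact: ext_mkseq.
  by have := Aw m n I; rewrite fixn Gp//; exact: ext_mkseq.
move=> [s /EF[t Ft]]; exists (fun n => (s n, t n)) => m n _.
case: ifPn => // /asboolP fixn.
by rewrite -(fixn (fun n => (s n, t n))) ?size_mkseq//; exact: Ft.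
Qed.

End souslin_projection.

(** * The measurable projection theorem *)

Section projection.
Context (R : realType) (V : completeNormedModType R).
Context (d : measure_display) (T : measurableType d) (P : probability T R).
Variable H : set_system T.
Hypothesis subH : sub_sigma_algebra_of H.

Lemma separable_dense_sequence : separable V ->
  exists x : nat -> V, forall v e, 0 < e -> exists k, `|x k - v| < e.
Proof.
move=> [D /countable_injP[f f_inj] D_dense].
(* f is injective on D, and x inverts it on f @` D *)
have [n|x Hx] := @choice nat V (fun n v => forall u, D u -> f u = n -> u = v).
  have [[u [Du fu]]|noD] := pselect (exists u, D u /\ f u = n).
    by exists u => u' Du' fu'; apply: f_inj; rewrite ?inE// fu.
  by exists 0 => u Du fu; case: noD; exists u.
exists x => v e e0.
have [||u [bu Du]] := D_dense (ball v e); [|exact: ball_open|].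
  by exists v; exact: ballxx.
exists (f u); rewrite -(Hx _ u)// distrC.
by move: bu; rewrite -ball_normE.
Qed.

Section coding.
Variable x : nat -> V.
Hypothesis x_dense : forall v e, 0 < e -> exists k, `|x k - v| < e.
Implicit Types (s : nat -> nat) (v : V) (Z : set (T * V)).

Definition codes s v := forall n, `|x (s n) - v| <= n.+1%:R^-1.

Lemma codes_exists v : exists s, codes s v.
Proof.
have /choice[s Hs] n : exists k, `|x k - v| < n.+1%:R^-1.
  by apply: x_dense; rewrite invr_gt0.
by exists s => n; exact/ltW.
Qed.

Definition consistent s := forall n m,
  `|x (s n) - x (s m)| <= n.+1%:R^-1 + m.+1%:R^-1.

Lemma codes_consistent s v : codes s v -> consistent s.
Proof.
move=> sv n m; have -> : x (s n) - x (s m) = (x (s n) - v) - (x (s m) - v).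
  by rewrite opprB addrA subrK.
by rewrite (le_trans (ler_normB _ _))// lerD.
Qed.

Lemma consistent_codes s : consistent s -> exists v, codes s v.
Proof.
move=> cs.
have /cauchy_cvgP/cvg_ex[v xv] : cauchy (x (s n) @[n --> \oo]).
  apply: cauchy_exP => e e0.
  have [N HN] := inv_natS_lt (divr_gt0 e0 (ltr0n _ 2)).
  exists (x (s N)), N => // n /= Nn; rewrite -ball_normE /ball_/=.
  by rewrite (le_lt_trans (cs _ _))// [ltRHS](splitr e) ltrD ?HN.
exists v => n; apply/ler_addgt0Pr => e e0.
have e20 : 0 < e / 2 by exact: divr_gt0.
have [N HN] := inv_natS_lt e20.
have /cvgrPdist_lt/(_ _ e20)[M _ HM] := xv.
pose k := maxn N M.
have -> : x (s n) - v = (x (s n) - x (s k)) + (x (s k) - v).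
  by rewrite addrA subrK.
rewrite (le_trans (ler_normD _ _))// (le_trans (lerD (cs n k) (lexx _)))//.
rewrite -addrA lerD2l [leRHS](splitr e) lerD// ltW//.
  by apply: HN; exact: leq_maxl.
by rewrite distrC; apply: HM; exact: leq_maxr.
Qed.

(** The pullback of [Z] along the coding is a Souslin family. Only sequences
    that code a point are constrained; the others are excluded at the end by
    [consistent]. *)
Definition coded Z := exists2 E, souslin_family H E &
  forall s v w, codes s v -> Z (w, v) <-> E s w.

Lemma coded_bigcup (Z : nat -> set (T * V)) :
  (forall k, coded (Z k)) -> coded (\bigcup_k Z k).
Proof.
move=> /(_ _)/cid2 cZ; exists (fun s => \bigcup_k sval (cZ k) s).
  by apply: souslin_family_bigcup => k; case: (cZ k).
by move=> s v w sv; split=> -[k _ Zk]; exists k => //; move: Zk;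
  case: (cZ k) => E /= _ /(_ _ _ w sv)[].
Qed.

Lemma coded_bigcap (Z : nat -> set (T * V)) :
  (forall k, coded (Z k)) -> coded (\bigcap_k Z k).
Proof.
move=> /(_ _)/cid2 cZ; exists (fun s => \bigcap_k sval (cZ k) s).
  by apply: souslin_family_bigcap => k; case: (cZ k).
by move=> s v w sv; split=> Zk k _; move: (Zk k I);
  case: (cZ k) => E /= _ /(_ _ _ w sv)[].
Qed.

Lemma coded_measurable_cylinder (A : set T) :
  H.-sigma.-measurable A -> coded (A `*` setT).
Proof.
move=> mA; exists (fun=> A); last by move=> s v w _; split => [[]|].
by apply: souslin_family_locally_constant => s; split => //; exists 0%N.
Qed.

Let good (U : set V) n k := forall y, `|x k - y| <= n.+1%:R^-1 -> U y.

(** Membership in an open set is decided by finitely many entries of a code: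
    at some stage the ball that must contain the limit is inside [U]. *)
Lemma open_codesP (U : set V) s v : open U -> codes s v ->
  U v <-> exists n, good U n (s n).
Proof.
move=> oU sv; split=> [Uv|[n]]; last by apply; exact: sv.
have [e /= e0 eU] : nbhs_ball v U by apply/nbhs_ballP; exact: open_nbhs_nbhs.
have [N /(_ N (leqnn N)) HN] := inv_natS_lt (divr_gt0 e0 (ltr0n _ 2)).
exists N => y xy; apply: eU; rewrite -ball_normE /ball_/=.
have -> : v - y = (x (s N) - y) - (x (s N) - v).
  by rewrite opprB [RHS]addrC subrKA.
rewrite (le_lt_trans (ler_normB _ _))// [ltRHS](splitr e).
by rewrite ltrD// (le_lt_trans _ HN)//; exact: sv.
Qed.

Let souslin_family_prop (Q : nat -> nat -> Prop) (n : nat) :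
  souslin_family H (fun s => if `[< Q n (s n) >] then setT else set0).
Proof.
apply: souslin_family_locally_constant => s; split.
  by case: ifP => _; [exact: measurableT|exact: measurable0].
by exists n.+1 => s' ss'; rewrite ss'.
Qed.

Lemma coded_open_cylinder (U : set V) : open U -> coded (setT `*` U).
Proof.
move=> oU.
exists (fun s => \bigcup_n if `[< good U n (s n) >] then setT else set0).
  by apply: souslin_family_bigcup => n; exact: souslin_family_prop.
move=> s v w sv; have UP := open_codesP oU sv; split.
  by move=> [_ /= /UP[n Un]]; exists n => //; case: asboolP.
by move=> [n _]; case: asboolP => // Un _; split => //; apply/UP; exists n.
Qed.

Lemma coded_closed_cylinder (U : set V) : open U -> coded (setT `*` ~` U).
Proof.
move=> oU.
exists (fun s => \bigcap_n if `[< ~ good U n (s n) >] then setT else set0).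
  apply: souslin_family_bigcap => n.
  exact: (souslin_family_prop (fun n k => ~ good U n k)).
move=> s v w sv; have UP := open_codesP oU sv; split.
  by move=> [_ /= Uv] n _; case: asboolP => // /contrapT Un; apply: Uv;
    apply/UP; exists n.
move=> Un; split => //= /UP[n gn]; move: (Un n I).
by case: asboolP => // /(_ gn).
Qed.

(** Coded sets need not be closed under complements. Asking the same of the
    complement gives a sigma-algebra, as coded sets are stable under both
    countable unions and countable intersections. *)
Definition bicoded Z := coded Z /\ coded (~` Z).

Lemma bicodedC Z : bicoded Z -> bicoded (~` Z).
Proof. by move=> [? ?]; split => //; rewrite setCK. Qed.

Lemma bicoded_bigcup (Z : nat -> set (T * V)) :
  (forall k, bicoded (Z k)) -> bicoded (\bigcup_k Z k).
Proof.
move=> cZ; split; first by apply: coded_bigcup => k; case: (cZ k).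
by rewrite setC_bigcup; apply: coded_bigcap => k; case: (cZ k).
Qed.

Lemma bicoded_measurable_cylinder (A : set T) :
  H.-sigma.-measurable A -> bicoded (A `*` setT).
Proof.
move=> mA; split; first exact: coded_measurable_cylinder.
rewrite (_ : ~` _ = ~` A `*` setT).
  by apply: coded_measurable_cylinder; exact: measurableC.
by apply/seteqP; split => -[w v] /=; [move=> h; split => // Aw; exact: h|
  move=> [h _] [/h]].
Qed.

Lemma bicoded_borel_cylinder (B : set V) :
  (@open V).-sigma.-measurable B -> bicoded (setT `*` B).
Proof.
have setTXC (C : set V) : setT `*` ~` C = ~` (setT `*` C) :> set (T * V).
  apply/seteqP; split => -[w v] /=; first by move=> [_ h] [].
  by move=> h; split => // Cv; exact: h.
move: B; apply: smallest_sub => [|U oU]; last first.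
  split; first exact: coded_open_cylinder.
  by rewrite -setTXC; exact: coded_closed_cylinder.
split.
- by rewrite setX0 -setCT -setXTT; apply/bicodedC/bicoded_measurable_cylinder.
- by move=> A cA; rewrite setTD setTXC; exact: bicodedC.
- move=> A cA; rewrite (_ : _ `*` _ = \bigcup_k (setT `*` A k)).
    exact: bicoded_bigcup.
  apply/seteqP; split => -[w v] /=; first by move=> [_ [k _ Av]]; exists k.
  by move=> [k _ [_ Av]]; split => //; exists k.
Qed.

Lemma measurable_bicoded (Z : set (T * V)) :
  measurable
    (Z : set (g_sigma_algebraType H * g_sigma_algebraType (@open V))%type) ->
  bicoded Z.
Proof.
rewrite measurable_prod_measurableType; move: Z; apply: smallest_sub.
  split.
  - rewrite -setCT -setXTT; apply/bicodedC/bicoded_measurable_cylinder.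
    exact: measurableT.
  - by move=> A cA; rewrite setTD; exact: bicodedC.
  - exact: bicoded_bigcup.
move=> _ [A mA [B mB <-]].
rewrite (_ : _ `*` _ = ~` (~` (A `*` setT) `|` ~` (setT `*` B))).
  rewrite -bigcup2E; apply/bicodedC/bicoded_bigcup => -[|[|k]] /=.
  - exact/bicodedC/bicoded_measurable_cylinder.
  - exact/bicodedC/bicoded_borel_cylinder.
  - rewrite -setCT -setXTT; apply/bicodedC/bicoded_measurable_cylinder.
    exact: measurableT.
rewrite -setCI setCK; apply/seteqP; split => -[w v] /=; first by move=> [].
by move=> [[] + _ [_]].
Qed.

Lemma souslin_family_consistent :
  souslin_family H (fun s => [set w | consistent s]).
Proof.
rewrite (_ : (fun s => _) = fun s => \bigcap_n \bigcap_m
    [set w : T | `|x (s n) - x (s m)| <= n.+1%:R^-1 + m.+1%:R^-1]).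
  apply: souslin_family_bigcap => n; apply: souslin_family_bigcap => m.
  apply: souslin_family_locally_constant => s; split.
    case: (`|x (s n) - x (s m)| <= _).
      rewrite (_ : mkset _ = setT); first exact: measurableT.
      by apply/seteqP; split.
    rewrite (_ : mkset _ = set0); first exact: measurable0.
    by apply/seteqP; split.
  exists (maxn n m).+1 => s' ss'.
  by rewrite -!ss'// ltnS ?leq_maxl ?leq_maxr.
apply/funext => s; apply/seteqP; split => w /=.
  by move=> cs n _ m _; exact: cs.
by move=> cs n m; exact: cs.
Qed.

End coding.

(** Completeness of [V] enters here: a consistent sequence has a limit, so the
    projection along [V] is the projection along consistent codes. *)
Theorem measurable_projection (X : T -> set V) : separable V ->
  random_set H X -> sandwiched P H [set w | X w !=set0].
Proof.
move=> /separable_dense_sequence[x x_dense] /(measurable_bicoded x).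
move=> [[E sE EX] _].
have sE' : souslin_family H
    (fun s => \bigcap_k (if k is 0%N then E s else [set w | consistent x s])).
  by apply: souslin_family_bigcap => -[//|k]; exact: souslin_family_consistent.
have := souslin_family_sandwiched P subH sE'.
congr (sandwiched P H _); apply/seteqP; split => w /=.
  move=> [s Es]; have [v sv] := consistent_codes (Es 1%N I).
  by exists v; apply/(EX _ _ w sv); exact: (Es 0%N I).
move=> [v Xv]; have [s sv] := codes_exists x_dense v.
by exists s => -[_|k _] /=; [exact/(EX _ _ w sv)|exact: codes_consistent sv].
Qed.

End projection.

(** * Extended random variables and their rational levels *)

Lemma ereal_rat_between (R : realType) (a b : \bar R) :
  (a < b)%E -> exists q : rat, (a < (ratr q)%:E)%E /\ ((ratr q)%:E < b)%E.
Proof.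
have itv (r s : R) : r < s -> exists q : rat, r < ratr q /\ ratr q < s.
  by move=> /rat_in_itvoo[q]; rewrite in_itv/= => /andP[rq qs]; exists q.
case: a => [r||]; case: b => [s||]//; rewrite ?lte_fin ?ltey ?ltNye//= => rs.
- by have [q [rq qs]] := itv _ _ rs; exists q; rewrite !lte_fin.
- have [|q [rq _]] := itv r (r + 1); first by rewrite ltrDl.
  by exists q; rewrite lte_fin ltry.
- have [|q [_ qs]] := itv (s - 1) s; first by rewrite gtrBl.
  by exists q; rewrite lte_fin ltNyr.
- by exists 0; rewrite ltNyr ltry.
Qed.

Lemma ae_forall_countable (d : measure_display) (T : measurableType d)
    (R : realType) (P : {measure set T -> \bar R}) (K : countType)
    (Q : K -> T -> Prop) :
  (forall k, {ae P, forall w, Q k w}) -> {ae P, forall w, forall k, Q k w}.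
Proof.
move=> aeQ.
have : {ae P, forall w, forall n, oapp (Q^~ w) True (unpickle n)}.
  apply: ae_foralln => n; case: (unpickle n) => [k|] /=; first exact: aeQ.
  exact: aeW.
by apply: filterS => w Qw k; have := Qw (pickle k); rewrite pickleK.
Qed.

Lemma measurable_fun_gt (d : measure_display) (T : measurableType d)
    (R : realType) (f : T -> \bar R) :
  (forall c : R, measurable [set w | (c%:E < f w)%E]) ->
  measurable_fun [set: T] f.
Proof.
move=> mf mD; apply: (measurability _ (ErealGenOInfty.measurableE R)) => //.
move=> _ [_ [r ->] <-]; rewrite setTI.
rewrite (_ : _ @^-1` _ = [set w | (r%:E < f w)%E])//.
by apply/seteqP; split => w /=; rewrite in_itv/= andbT.
Qed.

Section sup_level.
Context (R : realType).

(** Recovers an extended function from the events [B q] on which it exceeds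
    the rational [q]. *)
Definition sup_level (T : Type) (B : rat -> set T) (w : T) : \bar R :=
  ereal_sup [set (ratr q : R)%:E | q in [set q | B q w]].

Lemma le_sup_level (T : Type) (B : rat -> set T) w (c : \bar R) :
  (forall q, ((ratr q)%:E < c)%E -> B q w) -> (c <= sup_level B w)%E.
Proof.
move=> cB; rewrite leNgt; apply/negP => /ereal_rat_between[q [lq qc]].
move: lq; apply/negP; rewrite -leNgt; apply: ereal_sup_ubound.
by exists q => //; exact: cB.
Qed.

Lemma sup_level_le (T : Type) (B : rat -> set T) w (c : \bar R) :
  (forall q, B q w -> ((ratr q)%:E < c)%E) -> (sup_level B w <= c)%E.
Proof. by move=> Bc; apply: ge_ereal_sup => _ [q Bq <-]; exact/ltW/Bc. Qed.

Lemma measurable_sup_level (d : measure_display) (T : measurableType d)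
    (B : rat -> set T) :
  (forall q, measurable (B q)) -> measurable_fun [set: T] (sup_level B).
Proof.
move=> mB; apply: measurable_fun_gt => c.
rewrite (_ : [set w | _] =
    \bigcup_q (if c < ratr q then B q else set0)).
  by apply: bigcupT_measurable_rat => q; case: ifP.
apply/seteqP; split => w /=.
  move=> /ereal_sup_gt[_ [q Bq <-]]; rewrite lte_fin => cq.
  by exists q => //; rewrite cq.
move=> [q _]; case: ifPn => // cq Bq; apply/ereal_sup_gtP.
by exists (ratr q)%:E; [exists q|rewrite lte_fin].
Qed.

End sup_level.

Section cond_ess_sup.
Context (R : realType) (d : measure_display) (T : measurableType d).
Variables (P : probability T R) (H : set_system T).
Hypothesis subH : sub_sigma_algebra_of H.

Lemma measurable_wrt_gt (eta : T -> \bar R) (c : \bar R) :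
  measurable_wrt H eta -> H.-sigma.-measurable [set w | (c < eta w)%E].
Proof.
move=> mf; rewrite -[X in measurable X]setTI.
exact: emeasurable_fun_o_infty.
Qed.

(** For each rational [q], take the almost surely smallest event [B q] of [H]
    that almost surely contains the one where [eta] exceeds [q]; these are the
    levels of the essential supremum. *)
Lemma cond_ess_sup_exists (eta : T -> \bar R) :
  measurable_fun [set: T] eta -> exists e, is_cond_ess_sup P H eta e.
Proof.
move=> meta.
have mlevel q : measurable [set w | ((ratr q)%:E < eta w)%E].
  rewrite -[X in measurable X]setTI.
  exact: emeasurable_fun_o_infty.
pose G q : set (set T) := [set C | H.-sigma.-measurable C /\
  {ae P, forall w, ((ratr q)%:E < eta w)%E -> C w}].
have /choice[B HB] q : exists B, G q B /\ forall C, G q C -> P (B `\` C) = 0%E.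
  have [||A GA|B GB Bmin] := @directed_ae_minimum _ T R P (G q).
  - by exists setT; split; [exact: measurableT|exact: aeW].
  - by move=> C [/(sub_measurable subH)].
  - exists (\bigcap_n A n).
      split; first by apply: bigcapT_measurable => n; case: (GA n).
      have : {ae P, forall w, forall n, ((ratr q)%:E < eta w)%E -> A n w}.
        by apply: ae_foralln => n; case: (GA n).
      by apply: filterS => w Aw qw n _; exact: Aw.
    move=> n; rewrite (_ : _ `\` _ = set0) ?measure0// -subset0 => w [+ +].
    by move=> /(_ n I).
  by exists B.
exists (sup_level R B); split => //.
- by apply: (@measurable_sup_level R _ (g_sigma_algebraType H)) => q;
    case: (HB q) => -[].
- have : {ae P, forall w, forall q : rat, ((ratr q)%:E < eta w)%E -> B q w}.
    by apply: ae_forall_countable => q; case: (HB q) => -[].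
  by apply: filterS => w; exact: le_sup_level.
move=> e' me' ee'.
have : {ae P, forall w, forall q : rat, B q w -> ((ratr q)%:E < e' w)%E}.
  apply: ae_forall_countable => q; have [[mB _] Bmin] := HB q.
  have mC : H.-sigma.-measurable [set w | ((ratr q)%:E < e' w)%E].
    exact: measurable_wrt_gt.
  exists (B q `\` [set w | ((ratr q)%:E < e' w)%E]); split.
  - by apply: measurableD; exact: (sub_measurable subH).
  - apply: Bmin; split => //.
    by move: ee'; apply: filterS => w ew qw; exact: lt_le_trans ew.
  - by move=> w /= /not_implyP[Bw nC].
by apply: filterS => w; exact: sup_level_le.
Qed.

(** The outer events of the sandwiches serve as levels of [e], and the null
    sets of the countably many levels add up to a null set. *)
Lemma sandwiched_level_version (f : T -> \bar R) :
  (forall q : rat, sandwiched P H [set w | ((ratr q)%:E < f w)%E]) ->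
  exists e, [/\ measurable_wrt H e, forall w, (f w <= e w)%E &
    {ae P, forall w, (e w <= f w)%E}].
Proof.
move=> /choice[B /choice[N HN]]; exists (sup_level R B); split.
- by apply: (@measurable_sup_level R _ (g_sigma_algebraType H)) => q;
    case: (HN q).
- by move=> w; apply: le_sup_level => q qf; case: (HN q) => _ _ _ + _; apply.
have : {ae P, forall w : T, forall q, B q w -> ((ratr q)%:E < f w)%E}.
  apply: ae_forall_countable => q; have [mB mN N0 _ BN] := HN q.
  exists (N q); split; [exact: (sub_measurable subH)|exact: N0|].
  move=> w /= /not_implyP[Bw nf]; apply: contrapT => nN; apply: nf.
  exact: (BN w).
by apply: filterS => w; exact: sup_level_le.
Qed.

Lemma sandwiched_measurable (S : set T) : measure_is_complete P ->
  sandwiched P H S -> measurable S.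
Proof.
move=> cP [B [N [mB mN N0 SB BNS]]].
rewrite (_ : S = (B `\` N) `|` (S `&` N)).
  apply: measurableU.
    by apply: measurableD; exact: (sub_measurable subH).
  apply: cP; exists N; split => //; exact: (sub_measurable subH).
apply/seteqP; split => w; last by move=> [/BNS|[]].
move=> Sw; have [Nw|Nw] := pselect (N w); first by right.
by left; split => //; exact: SB.
Qed.

End cond_ess_sup.

(** * The conditional convex hull *)

Section convex_hull.
Context (R : realType) (V : completeNormedModType R).
Context (d : measure_display) (T : measurableType d) (P : probability T R).
Variable H : set_system T.
Hypothesis subH : sub_sigma_algebra_of H.
Implicit Types (X Y M : T -> set V) (U : set V).

Lemma random_setI_open X U :
  random_set H X -> open U -> random_set H (fun w => X w `&` U).
Proof.
move=> rX oU; have mU : (@open V).-sigma.-measurable U.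
  exact: sub_sigma_algebra.
rewrite /random_set (_ : [set p | _] = [set p | X p.1 p.2] `&` (setT `*` U)).
  by apply: measurableI => //; apply: measurableX.
by apply/seteqP; split => -[w v] /=; [move=> [Xv Uv]|move=> [Xv [_ Uv]]].
Qed.

Lemma closed_convex_superset_bigcap X (Y : nat -> T -> set V) :
  (forall n, closed_convex_superset P H X (Y n)) ->
  closed_convex_superset P H X (fun w => \bigcap_n Y n w).
Proof.
move=> HY; split.
- rewrite /random_set (_ : [set p | _] = \bigcap_n [set p | Y n p.1 p.2]).
    by apply: bigcapT_measurable => n; case: (HY n).
  by apply/seteqP; split => -[w v].
- have : {ae P, forall w, forall n, closed (Y n w)}.
    by apply: ae_foralln => n; case: (HY n).
  by apply: filterS => w cY; apply: closed_bigI => n _.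
- have : {ae P, forall w, forall n, @convex_set R V (Y n w)}.
    by apply: ae_foralln => n; case: (HY n).
  apply: filterS => w cY u v l; rewrite !inE => uY vY n _.
  by apply/set_mem/cY; rewrite inE; [exact: uY|exact: vY].
- have : {ae P, forall w, forall n, X w `<=` Y n w}.
    by apply: ae_foralln => n; case: (HY n).
  by apply: filterS => w XY v Xv n _; exact: XY.
Qed.

Lemma closed_convex_supersetT X : closed_convex_superset P H X (fun=> setT).
Proof.
split.
- rewrite /random_set (_ : [set p | _] = setT); first exact: measurableT.
  exact/seteqP.
- by apply: aeW => w; exact: closedT.
- by apply: aeW => w u v l _ _; rewrite inE.
- by apply: aeW => w.
Qed.

Lemma separable_countable_base : separable V -> exists U : nat -> set V,
  (forall n, open (U n)) /\
  forall v e, 0 < e -> exists n, U n v /\ U n `<=` ball v e.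
Proof.
move=> /separable_dense_sequence[x x_dense].
pose code (n : nat) : nat * nat := odflt (0, 0)%N (unpickle n).
exists (fun n => ball (x (code n).1) (code n).2.+1%:R^-1); split.
  by move=> n; exact: ball_open.
move=> v e e0; have [N HN] := inv_natS_lt (divr_gt0 e0 (ltr0n _ 2)).
have [|k xk] := x_dense v N.+1%:R^-1; first by rewrite invr_gt0.
exists (pickle (k, N)); rewrite /code pickleK /=; split.
  by rewrite -ball_normE.
rewrite -ball_normE => y; rewrite /ball_/= => xy.
have -> : v - y = (x k - y) - (x k - v) by rewrite opprB [RHS]addrC subrKA.
rewrite (le_lt_trans (ler_normB _ _))// [ltRHS](splitr e) ltrD//.
  by rewrite (lt_trans xy)// HN.
by rewrite (lt_trans xk)// HN.
Qed.

(** If [Z] is another superset, then so is [MZ], the intersection of [M] and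
    [Z]. By the choice of [Y n], almost surely [MZ] meets every [U n] that
    [Y n] meets, hence every [U n] that [M] meets; as [MZ] is closed, it
    contains [M]. *)
Lemma cond_convex_hull_exists X : measure_is_complete P -> separable V ->
  exists M, is_cond_convex_hull P H X M.
Proof.
move=> cP sepV; have [U [oU baseU]] := separable_countable_base sepV.
pose meets n Y := [set w | (Y w `&` U n) !=set0].
have /choice[Y HY] n : exists Y, closed_convex_superset P H X Y /\
    forall Z, closed_convex_superset P H X Z ->
      P (meets n Y `\` meets n Z) = 0%E.
  have [||A /(_ _)/cid2 HA|_ [Y cY <-] Ymin] := @directed_ae_minimum _ T R P
    [set meets n Y | Y in closed_convex_superset P H X].
  - by exists (meets n (fun=> setT)), (fun=> setT) => //;
      exact: closed_convex_supersetT.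
  - move=> _ [Y [rY _ _ _] <-]; apply: (sandwiched_measurable subH cP).
    exact: (measurable_projection P subH sepV (random_setI_open rY (oU n))).
  - exists (meets n (fun w => \bigcap_k sval (HA k) w)).
      exists (fun w => \bigcap_k sval (HA k) w) => //.
      by apply: closed_convex_superset_bigcap => k; case: (HA k).
    move=> k; rewrite (_ : _ `\` _ = set0) ?measure0// -subset0.
    move=> w [[v [Av Uv]]]; apply; case: (HA k) (Av k I) => /= Z _ <- Zv.
    by exists v.
  - by exists Y; split => // Z cZ; apply: Ymin; exists Z.
pose M w := \bigcap_n Y n w.
have cM : closed_convex_superset P H X M.
  by apply: closed_convex_superset_bigcap => n; case: (HY n).
exists M; split => // Z cZ.
pose MZ w := \bigcap_n (if n is 0%N then M w else Z w).
have cMZ : closed_convex_superset P H X MZ.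
  have := @closed_convex_superset_bigcap X
    (fun n => if n is 0%N then M else Z).
  rewrite (_ : (fun w => _) = MZ); first by apply; case.
  apply/funext => w; apply: eq_bigcap => // -[|n] _ //.
have mmeets Z' n : closed_convex_superset P H X Z' -> measurable (meets n Z').
  move=> [rZ _ _ _]; apply: (sandwiched_measurable subH cP).
  exact: (measurable_projection P subH sepV (random_setI_open rZ (oU n))).
have hits : {ae P, forall w, forall n, meets n (Y n) w -> meets n MZ w}.
  apply: ae_foralln => n; have [cY Ymin] := HY n.
  exists (meets n (Y n) `\` meets n MZ); split.
  - by apply: measurableD; exact: mmeets.
  - exact: Ymin.
  - by move=> w /= /not_implyP.
have [_ closedMZ _ _] := cMZ.
move: hits closedMZ; apply: filterS2 => w hits closedMZ v Mv.
suff /(_ 1%N I) : MZ w v by [].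
rewrite ((closure_id _).1 closedMZ) => B /nbhs_ballP[e /= e0 eB].
have [n [Uv Ue]] := baseU v e e0.
have [|y [MZy Uy]] := hits n; first by exists v; split => //; exact: Mv.
by exists y; split => //; exact/eB/Ue.
Qed.

End convex_hull.

(** * Support functions *)

Section support_functions.
Context (R : realType) (V : completeNormedModType R).
Context (d : measure_display) (T : measurableType d) (P : probability T R).
Variable H : set_system T.
Hypothesis subH : sub_sigma_algebra_of H.
Implicit Types (X M : T -> set V) (zeta : T -> dual V).

Lemma support_function_gtP (A : set V) (u : dual V) (c : \bar R) :
  (c < support_function A u)%E <-> exists2 v, A v & (c < (u v : R)%:E)%E.
Proof.
split=> [/ereal_sup_gtP[_ [v Av <-] cv]|[v Av cv]]; first by exists v.
by apply/ereal_sup_gtP; exists (u v : R)%:E => //; exists v.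
Qed.

(** Expresses the strict inequality through the values of [u] on a dense
    sequence, which are the ones whose measurability is given. *)
Lemma pairing_gtP (x : nat -> V) (u : dual V) (v : V) (c : R) :
  (forall v e, 0 < e -> exists k, `|x k - v| < e) ->
  c < u v <-> exists (q : rat) (j : nat), c < ratr q /\
    forall k, `|x k - v| < j.+1%:R^-1 -> ratr q <= u (x k).
Proof.
move=> x_dense; have cu := @dual_continuous R V u v.
split=> [/rat_in_itvoo[q]|[q [j [cq Hq]]]].
  rewrite in_itv/= => /andP[cq qu]; exists q.
  have : nbhs v [set y | ratr q < u y :> R].
    apply: (cu [set y : R | ratr q < y]).
    by apply: open_nbhs_nbhs; split => //; exact: open_gt.
  move=> /nbhs_ballP[e /= e0 eq].
  have [N HN] := inv_natS_lt e0.
  exists N; split => // k xk; apply/ltW/eq.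
  by rewrite -ball_normE /ball_/= distrC (lt_trans xk)// HN.
apply: (lt_le_trans cq); rewrite leNgt; apply/negP => uq.
have : nbhs v [set y | u y < ratr q :> R].
  apply: (cu [set y : R | y < ratr q]).
  by apply: open_nbhs_nbhs; split => //; exact: open_lt.
move=> /nbhs_ballP[e /= e0 eq].
have [|k] := x_dense v (Num.min e j.+1%:R^-1).
  by rewrite lt_min e0 invr_gt0 ltr0n.
rewrite lt_min => /andP[ke kj]; have := Hq k kj; apply/negP; rewrite -ltNge.
by apply: eq; rewrite -ball_normE /ball_/= distrC.
Qed.

(** Joint measurability of a Caratheodory function: measurable in the first
    variable, continuous in the second. *)
Lemma measurable_pairing zeta : separable V -> L0_dual H zeta ->
  measurable_fun
    [set: (g_sigma_algebraType H * g_sigma_algebraType (@open V))%type]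
    (fun p => (zeta p.1 p.2 : R)%:E).
Proof.
move=> /separable_dense_sequence[x x_dense] mz; apply: measurable_fun_gt => c.
pose F (q : rat) (j k : nat) : set (T * V) :=
  (setT `*` ~` ball (x k) j.+1%:R^-1) `|`
  ([set w | ratr q <= (zeta w (x k) : R)] `*` setT).
rewrite (_ : [set p | _] =
  \bigcup_q (if c < ratr q then \bigcup_j \bigcap_k F q j k else set0)).
  apply: bigcupT_measurable_rat => q; case: ifP => // _.
  apply: bigcupT_measurable => j; apply: bigcapT_measurable => k.
  apply: measurableU; apply: measurableX => //.
    by apply: measurableC; apply: sub_sigma_algebra; exact: ball_open.
  have := mz (x k) measurableT _ (measurable_itv `[(ratr q : R), +oo[).
  rewrite setTI; congr (measurable _); apply/seteqP.
  by split => w /=; rewrite in_itv/= andbT.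
apply/seteqP; split => -[w v] /=; rewrite lte_fin.
  move=> /(pairing_gtP _ _ _ x_dense)[q [j [cq Hq]]].
  exists q => //; rewrite cq; exists j => // k _.
  have [xk|xk] := pselect (ball (x k) j.+1%:R^-1 v); last by left.
  by right; split => //; apply: Hq; move: xk; rewrite -ball_normE.
move=> [q _]; case: ifPn => // cq [j _ Hq].
apply/(pairing_gtP _ _ _ x_dense); exists q, j; split => // k xk.
case: (Hq k I) => -[//= _]; case.
by rewrite -ball_normE.
Qed.

Lemma closed_half_space (u : dual V) (a : \bar R) :
  closed [set v | ((u v : R)%:E <= a)%E].
Proof.
case: a => [r||].
- rewrite (_ : [set v | _] = u @^-1` [set y : R | y <= r]).
    apply: preimage_closed; last exact: closed_le.
    by move=> v _; exact: dual_continuous.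
  by apply/seteqP; split => v /=; rewrite lee_fin.
- rewrite (_ : [set v | _] = setT); first exact: closedT.
  by apply/seteqP; split => v //= _; rewrite leey.
- rewrite (_ : [set v | _] = set0); first exact: closed0.
  by apply/seteqP; split => v.
Qed.

Lemma convex_half_space (u : dual V) (a : \bar R) :
  @convex_set R V [set v | ((u v : R)%:E <= a)%E].
Proof.
move=> v w l; rewrite !inE/=; case: a => [r||]; rewrite ?leey//.
rewrite !lee_fin => vr wr.
have -> : u (conv l v w) = l%:num * u v + (1 - l%:num) * u w :> R.
  by rewrite linearD !linearZ.
have -> : r = l%:num * r + (1 - l%:num) * r by rewrite -mulrDl subrKC mul1r.
by rewrite lerD// ler_wpM2l// subr_ge0.
Qed.

Lemma support_function_level_sandwiched X zeta (c : \bar R) :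
  separable V -> L0_dual H zeta -> random_set H X ->
  sandwiched P H [set w | (c < support_function (X w) (zeta w))%E].
Proof.
move=> sepV mz rX.
have rXc : random_set H (fun w => [set v | X w v /\ (c < (zeta w v : R)%:E)%E]).
  rewrite /random_set (_ : [set p | _] = [set p | X p.1 p.2] `&`
    [set p | (c < (zeta p.1 p.2 : R)%:E)%E])//.
  apply: measurableI => //; rewrite -[X in measurable X]setTI.
  by apply: emeasurable_fun_o_infty => //; exact: measurable_pairing.
have := measurable_projection P subH sepV rXc.
congr (sandwiched P H _); apply/seteqP; split => w /=.
  by move=> [v [Xv cv]]; apply/support_function_gtP; exists v.
by move=> /support_function_gtP[v Xv cv]; exists v.
Qed.

(** The half-space contains [X] because its bound dominates the support
    function of [X]. *)
Lemma closed_convex_superset_half_space X M zeta (e : T -> \bar R) :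
  separable V -> L0_dual H zeta -> closed_convex_superset P H X M ->
  measurable_wrt H e ->
  {ae P, forall w, (support_function (X w) (zeta w) <= e w)%E} ->
  closed_convex_superset P H X
    (fun w => M w `&` [set v | ((zeta w v : R)%:E <= e w)%E]).
Proof.
move=> sepV mz [rM closedM convexM XM] me Xe; split.
- rewrite /random_set (_ : [set p | _] = [set p | M p.1 p.2] `&`
    ~` [set p | (e p.1 < (zeta p.1 p.2 : R)%:E)%E]).
    apply: measurableI => //; apply: measurableC.
    rewrite -[X in measurable X]setTI; apply: measurable_lte => //.
      exact: (measurableT_comp me measurable_fst).
    exact: measurable_pairing.
  apply/seteqP; split => -[w v] /= [Mv ve]; split => //.
    by apply/negP; rewrite -leNgt.
  by rewrite leNgt; exact/negP.
- move: closedM; apply: filterS => w cM; apply: closedI => //.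
  exact: closed_half_space.
- move: convexM; apply: filterS => w cM u v l.
  rewrite !inE => -[Mu ue] [Mv ve]; split.
    by apply/set_mem/cM; rewrite inE.
  by apply/set_mem/(@convex_half_space (zeta w) (e w)); rewrite inE.
- move: XM Xe; apply: filterS2 => w XM Xe v Xv; split; first exact: XM.
  by apply: le_trans Xe; apply: ereal_sup_ubound; exists v.
Qed.

End support_functions.

Theorem theorem5p2 (R : realType) (V : completeNormedModType R)
    (d : measure_display) (T : measurableType d) (P : probability T R)
    (H : set_system T) (X : T -> set V)
    (sepV : separable V) (completeP : measure_is_complete P)
    (subH : sub_sigma_algebra_of H) (rX : random_set (@measurable d T) X) :
  (exists M : T -> set V, is_cond_convex_hull P H X M) /\
  forall M : T -> set V, is_cond_convex_hull P H X M ->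
  forall zeta : T -> dual V, L0_dual H zeta ->
    let hX := fun w => support_function (X w) (zeta w) in
    let hM := fun w => support_function (M w) (zeta w) in
    (exists e : T -> \bar R, is_cond_ess_sup P H hX e) /\
    (forall e : T -> \bar R, is_cond_ess_sup P H hX e ->
       {ae P, forall w, hM w = e w}).
Proof.
split; first exact: cond_convex_hull_exists.
move=> M [cM Mmin] zeta mz hX hM; split.
  apply: cond_ess_sup_exists => //; apply: measurable_fun_gt => c.
  have subT : sub_sigma_algebra_of (@measurable d T).
    by split => //; exact: sigma_algebra_measurable.
  apply: (sandwiched_measurable subT completeP).
  apply: support_function_level_sandwiched => // x mT B mB.
  apply: sub_sigma_algebra; apply: (sub_measurable subH).
  exact: mz.
move=> e [_ me Xe emin].
have Me : {ae P, forall w, (hM w <= e w)%E}.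
  have := Mmin _ (closed_convex_superset_half_space sepV mz cM me Xe).
  apply: filterS => w Me; apply: ge_ereal_sup => _ [v Mv <-].
  by have [] := Me v Mv.
(* h_M(zeta) has an H-measurable version, to which minimality of e applies *)
have [_ _ _ XM] := cM; have [rM _ _ _] := cM.
have [e' [me' Me' e'M]] := @sandwiched_level_version _ _ _ P H subH hM
  (fun q => support_function_level_sandwiched P subH _ sepV mz rM).
have ee' : {ae P, forall w, (e w <= e' w)%E}.
  apply: emin => //; move: XM; apply: filterS => w XM.
  apply: le_trans (Me' w); apply: ereal_sup_le => _ [v Xv <-].
  by exists v => //; exact: XM.
have eM : {ae P, forall w, (e w <= hM w)%E}.
  by move: ee' e'M; apply: filterS2 => w; exact: le_trans.
by move: Me eM; apply: filterS2 => w Me eM; apply/eqP; rewrite eq_le Me.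
Qed.
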